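(* Let $\mathfrak{g}$ be a finite dimensional nilpotent Lie algebra over a field $\mathbb{F}$ of characteristic zero. Then there exists a non-zero, symmetric and invariant bilinear form $f:\mathfrak{g}\times\mathfrak{g}\to\mathbb{F}$.
   Context: A bilinear form $f:\mathfrak{g}\times\mathfrak{g}\to\mathbb{F}$ on a Lie algebra $\mathfrak{g}$ with bracket $[\,\cdot\,,\,\cdot\,]$ is invariant if $f([x,y],z)=-f(y,[x,z])$ for all $x,y,z\in\mathfrak{g}$.
   Formalization: The Lie algebra is assumed to be non-zero: the zero Lie algebra is finite dimensional and nilpotent, but its only bilinear form is zero, so the claim fails for it. *)

(* Defs.v *)
From HB Require Import structures.
From mathcomp Require Import all_boot all_order all_algebra.

Set Implicit Arguments.
Unset Strict Implicit.
Unset Printing Implicit Defensive.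

Import GRing.Theory.
Local Open Scope ring_scope.

HB.mixin Record Lmodule_isLieAlgebra (F : fieldType) L of GRing.Lmodule F L := {
  lie_bracket : L -> L -> L;
  lie_linearl : forall y : L, linear (lie_bracket^~ y);
  lie_linearr : forall x : L, linear (lie_bracket x);
  lie_alt : forall x : L, lie_bracket x x = 0;
  lie_jacobi : forall x y z : L,
    lie_bracket x (lie_bracket y z) + lie_bracket y (lie_bracket z x) +
    lie_bracket z (lie_bracket x y) = 0
}.

#[short(type="lieAlgType")]
HB.structure Definition LieAlgebra (F : fieldType) :=
  { L of GRing.Lmodule F L & Lmodule_isLieAlgebra F L }.

#[short(type="finLieAlgType")]
HB.structure Definition FinLieAlgebra (F : fieldType) :=
  { L of LieAlgebra F L & Vector F L }.

Reserved Notation "[ 'lie' x , y ]" (format "[ 'lie'  x ,  y ]").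
Notation "[ 'lie' x , y ]" := (lie_bracket x y) : ring_scope.

HB.instance Definition _ (F : fieldType) (L : lieAlgType F) :=
  bilinear_isBilinear.Build F L L L *:%R *:%R (@lie_bracket F L)
    (@lie_linearl F L, @lie_linearr F L).

Section LowerCentralSeries.
Variables (F : fieldType) (L : finLieAlgType F).
Implicit Types (x y : L) (U V W : {vspace L}).

(* As for [prodv], bases suffice to generate the span of all brackets: see
   [memv_bracket] and [bracketvP]. *)
Definition bracketv U V : {vspace L} :=
  <<[seq [lie u, v] | u <- vbasis U, v <- vbasis V]>>%VS.

Lemma memv_bracket U V x y :
  x \in U -> y \in V -> [lie x, y] \in bracketv U V.
Proof.
move=> /coord_vbasis-> /coord_vbasis->.
rewrite linear_sumlz; apply: memv_suml => i _.
rewrite linear_sumr; apply: memv_suml => j _.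
rewrite linearZl_LR linearZr_LR !memvZ // memv_span //.
by apply/allpairsP; exists ((vbasis U)`_i, (vbasis V)`_j); rewrite !memt_nth.
Qed.

Lemma bracketvP U V W :
  reflect (forall x y, x \in U -> y \in V -> [lie x, y] \in W)
          (bracketv U V <= W)%VS.
Proof.
apply: (iffP idP) => [sUVW x y Ux Vy | sUVW].
  exact/(subvP sUVW)/memv_bracket.
apply/span_subvP=> _ /allpairsP[[u v] /= [Uu Vv ->]].
by rewrite sUVW ?vbasis_mem.
Qed.

Definition lower_central n : {vspace L} := iter n (bracketv fullv) fullv.

Definition lie_nilpotent : Prop := exists n, lower_central n = 0%VS.

End LowerCentralSeries.

Definition form_invariant (F : fieldType) (L : lieAlgType F)
    (f : {bilinear L -> L -> F | *%R & *%R}) : Prop :=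
  forall x y z : L, f [lie x, y] z = - f y [lie x, z].

Definition form_symmetric (F : fieldType) (L : lmodType F)
    (f : {bilinear L -> L -> F | *%R & *%R}) : Prop :=
  forall x y : L, f x y = f y x.

Definition form_nonzero (F : fieldType) (L : lmodType F)
    (f : {bilinear L -> L -> F | *%R & *%R}) : Prop :=
  exists x y : L, f x y != 0.

Arguments lie_nilpotent {F} L.

(* Main.v *)
Require Import Defs.
From HB Require Import structures.
From mathcomp Require Import all_boot all_order all_algebra.

Import GRing.Theory.
Local Open Scope ring_scope.

(** A nonzero nilpotent Lie algebra is not perfect: if [[g, g] = g] then every
    term of the lower central series is [g]. Hence there is a nonzero linear
    functional [phi] on [g] that vanishes on [[g, g]], and the form
    [(x, y) |-> phi x * phi y] is as required: it is symmetric, it takes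
    a nonzero value on the diagonal, and it is invariant because
    [phi [x, y] * phi z] and [phi y * phi [x, z]] are both zero. *)

(** The functional is a coordinate of [id - projv W], a linear map whose
    kernel is [W]. *)
Lemma separating_functional (F : fieldType) (V : vectType F) (W : {vspace V})
    (v : V) :
  v \notin W ->
  exists phi : {scalar V}, (forall w, w \in W -> phi w = 0) /\ phi v != 0.
Proof.
move=> vW; pose p : 'End(V) := (\1 - projv W)%VF.
have pE x : p x = x - projv W x by rewrite add_lfunE opp_lfunE id_lfunE.
have pv_neq0 : p v != 0.
  rewrite pE subr_eq0; apply: contraNneq vW => ->.
  exact: memv_proj.
have [i ci] : exists i, coord (vbasis fullv) i (p v) != 0.
  apply/existsP; apply: contraNT pv_neq0; rewrite negb_exists => /forallP c0.
  rewrite (coord_vbasis (memvf (p v))) big1 // => i _.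
  by move/negPn/eqP: (c0 i) => ->; rewrite scale0r.
exists (coord (vbasis fullv) i \o p); split=> // w wW.
by rewrite /= pE projv_id // subrr linear0.
Qed.

Lemma nilpotent_not_perfect (F : fieldType) (g : finLieAlgType F) :
  (fullv : {vspace g}) != 0%VS -> lie_nilpotent g ->
  bracketv (fullv : {vspace g}) fullv != fullv.
Proof.
move=> g_neq0 [n lcn0]; apply: contraNneq g_neq0 => perf.
rewrite -lcn0; apply/eqP; elim: n {lcn0} => // n IHn.
by rewrite /lower_central iterS -/(lower_central g n) -IHn perf.
Qed.

(** The tensor square of a linear functional. *)
Definition square_form {F : fieldType} {V : lmodType F} (phi : {scalar V})
    (x y : V) : F := phi x * phi y.

Lemma square_form_linearl {F : fieldType} {V : lmodType F} (phi : {scalar V})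
    (y : V) : scalar ((square_form phi)^~ y).
Proof. by move=> a u v; rewrite /square_form linearP mulrDl mulrA. Qed.

Lemma square_form_linearr {F : fieldType} {V : lmodType F} (phi : {scalar V})
    (x : V) : scalar (square_form phi x).
Proof. by move=> a u v; rewrite /square_form linearP mulrDr mulrCA. Qed.

HB.instance Definition _ (F : fieldType) (V : lmodType F) (phi : {scalar V}) :=
  bilinear_isBilinear.Build F V V F *%R *%R (square_form phi)
    (square_form_linearl phi, square_form_linearr phi).

Theorem mainTheorem8 (F : fieldType) (charF0 : [pchar F] =i pred0)
    (g : finLieAlgType F) (g_neq0 : (fullv : {vspace g}) != 0%VS)
    (nil_g : lie_nilpotent g) :
  exists f : {bilinear g -> g -> F | *%R & *%R},
    form_nonzero f /\ form_symmetric f /\ form_invariant f.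
Proof.
have /subvPn[v _ vN] : ~~ (fullv <= bracketv (fullv : {vspace g}) fullv)%VS.
  apply: contra (nilpotent_not_perfect _ g g_neq0 nil_g) => full.
  by rewrite eqEsubv subvf.
have [phi [phi0 phiv]] := separating_functional _ _ _ _ vN.
have phi_bracket x y : phi [lie x, y] = 0.
  by apply: phi0; apply: memv_bracket; apply: memvf.
exists (square_form phi); split; [|split].
- by exists v, v; rewrite /= /square_form mulf_neq0.
- by move=> x y; rewrite /= /square_form mulrC.
- by move=> x y z; rewrite /= /square_form !phi_bracket mul0r mulr0 oppr0.
Qed.
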